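(* Procedure Dynamic-Synch (defined in the context), executed by the $m$ processors of a single-hop network that wake up in the global time interval $[0,n]$, synchronizes the clocks of the $m$ processors. The energy efficiency per processor is $O(\sqrt{n/m})$.
   Context: Model. A single-hop network consists of $m$ processors with distinct identities (Ids) $1,\dots,m$, any two of which are in communication range of each other. Global time is divided into discrete time units and is not available to the processors. Each processor wakes up at the beginning of an arbitrary global time unit in $\{0,1,\dots,n\}$; $n$ and $m$ are known to all processors. On wake-up its physical and logical clocks start counting from $0$; all clocks tick at the same speed (one increment per time unit), and logical clocks may be reset by the algorithm. In each time unit a processor's radio is on or off. Two processors can communicate in a time unit if and only if both have their radios on in it (there is no interference); then they are said to overlap. Processors synchronize their clocks if after the time point of synchronization their logical clocks show the same value at the same time. The energy efficiency of a processor is the number of time units during which its radio is on. The $k$-basic policy, for an integer $k>0$: the radio is on for $k$ consecutive time units (the initial part); then, during the following $k^2$ time units (the main part), it is on exactly in time units $k,2k,3k,\dots,k^2$ counted from the beginning of the main part. Clock updates (Early-Synch rule). A processor $u$ performing a policy keeps a counter $J_u$, set to $0$ when the policy starts and incremented in each time unit. Whenever its radio is on it sends $(id_u,\tau_u,J_u)$, where $\tau_u$ is its clock value. On receiving $(id_v,\tau_v,J_v)$, if $J_u<J_v$, or $J_u=J_v$ and $id_u<id_v$, it sets its clock to $\tau_v$ and $J_u:=J_v$. Procedure Dynamic-Synch, for each processor $v$: Step 1. Set $k:=\lceil\sqrt{8n/m}\,\rceil$ and, upon wake-up, perform the initial part of the $k$-basic policy. Step 2. If during step 1 either (i) $v$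 does not discover any other processor whose radio is on, or (ii) all discovered processors woke up after $v$, or at the same time as $v$ but have smaller Ids than $v$, then $v$ initializes a cluster and an empty queue, enqueues itself on it, and starts the main part of its policy once the initial part is complete. Step 3 (dynamic flattening). Otherwise, a queue $q$ is initialized and maintained by a processor $u$ that is currently executing the main part of its policy ($q$ was created by the earliest processor of the cluster and passed on from processor to processor; a processor creating the queue also enqueues the processors it hears during its initial part, and informs them of their positions at the end of that part, with $r=0$ below). Then $v$ is enqueued on $q$ by communicating with $u$, and receives its position $\ell$ in $q$. If $u$ has performed the main part of its policy for $r$ rounds when communicating with $v$, then $v$ schedules its next $k$-basic policy execution so that the main part of its policy is executed in $(\ell-1)k^2-r$ time units. Thus the policies of the processors in $q$ are executed immediately one after the other, in the order in which they appear in $q$. Step 4. Once a processor completes its main part, it dequeues itself from $q$ and passes $q$ to the next scheduled processor (with which it necessarily overlaps). Step 5. Independently of steps 1–4, execute the $k$-basic policy at time $2n+1$ from wake-up.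
   Formalization: The energy bound O(√(n/m)) fails uniformly when m is much larger than n (each radio is on at least once if n>0), so it is proved as O(⌈√(n/m)⌉) for all n, m, and literally as O(√(n/m)) for m ≤ n. *)

(* Defs.v *)
From mathcomp Require Import all_boot all_order all_algebra all_fingroup.
From mathcomp Require Import reals.

Set Implicit Arguments.
Unset Strict Implicit.
Unset Printing Implicit Defensive.

Import Order.TTheory GRing.Theory Num.Theory.

(* Processors are the elements of 'I_m; only the order of the Ids matters, so
   the Id i.+1 is represented by the ordinal i.  Time units are natural numbers
   of the global clock.  Processors have no access to it; a global date stored
   in the state below always stands for a delay with respect to the time unit
   in which the processor learns it.

   What the procedure leaves open is part of the scenario:
   [arrival t u] is the order in which u handles the messages it receives
   simultaneously in time unit t, and [qorder t u] is the order in which u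
   enqueues several processors in time unit t. *)
Record scenario (m : nat) := Scenario {
  wake : 'I_m -> nat;
  arrival : nat -> 'I_m -> {perm 'I_m};
  qorder : nat -> 'I_m -> {perm 'I_m}
}.

(* M is the time at which the main part of a k-basic policy starts; its initial
   part starts at M - k.  Subtraction is avoided because M may be smaller than k
   when a part of the initial part is already past. *)
Definition in_initial (k M t : nat) : bool := (M <= t + k) && (t < M).

Definition in_main (k M t : nat) : bool := (M <= t) && (t < M + k ^ 2).

(* Time units of the main part are counted from 1: t has number (t - M).+1. *)
Definition policy_on (k M t : nat) : bool :=
  in_initial k M t || in_main k M t && (k %| (t - M).+1).

(* State at the beginning of a time unit.
   [clock] is the logical clock.
   [counter] is the counter J of the clock update rule.
   [heard u] is the set of the processors that u discovered while performing the
   initial part that follows its wake-up.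
   [main u] is the time at which the main part of u starts, once u knows it (the
   main part of the late policy, started (2 * n).+1 time units after wake-up, is
   not concerned).
   [queue u] is the queue if u currently maintains it, with u at its head, and
   [::] otherwise. *)
Record state (m : nat) := State {
  clock : 'I_m -> nat;
  counter : 'I_m -> nat;
  heard : 'I_m -> {set 'I_m};
  main : 'I_m -> option nat;
  queue : 'I_m -> seq 'I_m
}.

Section DynamicSynch.

Variables (n m k : nat) (sc : scenario m).
Implicit Types (s : state m) (t : nat) (u v : 'I_m).

Let W := wake sc.

Definition init_state : state m :=
  State (fun=> 0) (fun=> 0) (fun=> set0) (fun=> None) (fun=> [::]).

Definition wakeup_part t u : bool := in_initial k (W u + k) t.

Definition radio_on s t u : bool :=
  [|| wakeup_part t u,
      (if main s u is Some M then policy_on k M t else false)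
    | policy_on k (W u + (2 * n).+1 + k) t].

(* u handles the message (v, clock s v, counter s v); cj holds the values of the
   clock and of the counter of u at that moment. *)
Definition receive s u (cj : nat * nat) v : nat * nat :=
  if (cj.2 < counter s v) || (cj.2 == counter s v) && (u < v)
  then (clock s v, counter s v) else cj.

(* All messages of time unit t carry the values at the beginning of the unit. *)
Definition early_synch s t u : nat * nat :=
  if radio_on s t u then
    foldl (receive s u) (clock s u, counter s u)
      [seq v <- map (arrival sc t u) (enum 'I_m) | (v != u) && radio_on s t v]
  else (clock s u, counter s u).

Definition heard_next s t u : {set 'I_m} :=
  if wakeup_part t u
  then heard s u :|: [set v | (v != u) && radio_on s t v] else heard s u.

Definition earliest s t u : bool :=
  [forall v in heard_next s t u, (W u < W v) || (W u == W v) && (v < u)].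

(* Decided in the last time unit of the initial part that follows wake-up. *)
Definition creates s t u : bool := (t.+1 == W u + k) && earliest s t u.

Definition maintains s t u : bool :=
  (queue s u != [::]) &&
  (if main s u is Some M then in_main k M t else false).

(* u enqueues v and informs v of its position, which requires both radios to be
   on.  The creator of a queue does so at the end of its initial part for all
   the processors heard during it. *)
Definition enqueues s t u v : bool :=
  [&& v != u, radio_on s t u, radio_on s t v, main s v == None &
      (creates s t u && (v \in heard_next s t u))
   || [&& maintains s t u, wakeup_part t v & ~~ earliest s t v]].

Definition host s t v : option 'I_m := [pick u | enqueues s t u v].

(* The queue after the enqueue operations of time unit t, before it is passed
   on. *)
Definition queue_mid s t u : seq 'I_m :=
  (if creates s t u then [:: u] else queue s u) ++
  [seq v <- map (qorder sc t u) (enum 'I_m) | host s t v == Some u].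

(* The number r of time units of its main part that u has performed at the end
   of time unit t. *)
Definition rounds s t u : nat :=
  if creates s t u then 0 else if main s u is Some M then t.+1 - M else 0.

(* The delay (l - 1) * k ^ 2 - r is counted from the end of time unit t;
   [index v q] is l - 1 for the position l of v in q. *)
Definition main_next s t v : option nat :=
  if creates s t v then Some t.+1
  else if host s t v is Some u then
    Some (t.+1 + (index v (queue_mid s t u) * k ^ 2 - rounds s t u))
  else main s v.

Definition completes s t u : bool :=
  maintains s t u &&
  (if main s u is Some M then t.+1 == M + k ^ 2 else false).

(* The queue is passed on by communication: it would be lost if the two
   processors did not overlap. *)
Definition passes s t u v : bool :=
  [&& completes s t u, ohead (behead (queue_mid s t u)) == Some v,
      radio_on s t u & radio_on s t v].

Definition queue_next s t u : seq 'I_m :=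
  if [pick w | passes s t w u] is Some w then behead (queue_mid s t w)
  else if completes s t u then [::] else queue_mid s t u.

(* M is the start of the main part of u, if known.  If u learns M less than k
   time units in advance, the nominal start M - k of that policy is already
   past: what remains of its initial part prolongs the initial part that u is
   performing, and the counter is not reset. *)
Definition starts (M : option nat) t u : bool :=
  [|| t == W u, t == W u + (2 * n).+1 | M == Some (t + k)].

(* Clocks are at 0 up to and including the time unit of wake-up. *)
Definition next s t : state m := {|
  clock := fun u => if t < W u then 0 else (early_synch s t u).1.+1;
  counter := fun u =>
    if starts (main_next s t u) t.+1 u then 0 else (early_synch s t u).2.+1;
  heard := heard_next s t;
  main := main_next s t;
  queue := queue_next s t
|}.

Fixpoint run t : state m := if t is t'.+1 then next (run t') t' else init_state.

(* Restricted to the time units before a horizon N. *)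
Definition energy u (N : nat) : nat := \sum_(t < N) radio_on (run t) t u.

Definition synchronizes : Prop :=
  exists t0, (forall u, W u <= t0) /\
    forall t, t0 <= t -> forall u v, clock (run t) u = clock (run t) v.

End DynamicSynch.

Definition synch_k (R : realType) (n m : nat) : nat :=
  `|Num.ceil (Num.sqrt (8 * n%:R / m%:R : R)%R)|%N.

(* Main.v *)
(* The clusters run one after the other: whenever a processor is in its main part,
   it overlaps with every processor that wakes up in the meantime, which therefore
   joins the queue; hence a new cluster is only created once the previous one is
   exhausted.  A cluster of [q] processors keeps some main part running during
   [q * k ^ 2] consecutive time units, and [m * k ^ 2 >= 8 * n], so some cluster
   still runs when the late policies of the processors of all earlier clusters
   start.  In the running cluster, the head of the queue is on once
   every [k] time units with a counter at least [k], whereas a processor whose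
   clock disagrees with the cluster has a counter below [k] and is on until the
   next such time unit, when it adopts the clock of the cluster. *)
Require Import Defs.
From mathcomp Require Import all_boot all_order all_algebra all_fingroup.
From mathcomp Require Import reals zify lra.

Set Implicit Arguments.
Unset Strict Implicit.
Unset Printing Implicit Defensive.

(** * Positions in a list whose prefix has been dropped *)

Lemma index_drop (T : eqType) (r : seq T) i (x : T) : x \notin take i r -> i <=
  size r ->
  index x (drop i r) = index x r - i.
Proof.
by move=> xi ir; rewrite -{2}(cat_take_drop i r) index_cat (negbTE xi)
  size_takel // addKn.
Qed.

Lemma ohead_drop (T : eqType) (r : seq T) i x : uniq r ->
  (ohead (drop i r) == Some x) = (i < size r) && (index x r == i).
Proof.
move=> ur; case: ltnP => ir; last by rewrite drop_oversize.
rewrite (drop_nth x ir) /=; apply/eqP/eqP => [[xi]|xi].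
  by rewrite -{1}xi index_uniq.
by rewrite -xi nth_index // -index_mem xi.
Qed.

(** * Effect of one time unit on clocks, counters and main parts *)

Section Procedure.



Variables (n m k : nat) (sc : scenario m).
Implicit Types (s : state m) (t : nat) (u v x y : 'I_m).

Let W := wake sc.
Let st := run n k sc.
Notation on := (radio_on n k sc).
Notation synch := (early_synch n k sc).

(** Whatever the arrival order, handling the messages is a running maximum on counters: the pair
    kept is always that of a single processor, [u] itself or one overlapping with it. *)
Lemma early_synchP s t u :
  exists v, [/\ (v == u) || on s t u && on s t v,
    synch s t u = (clock s v, counter s v),
    counter s u <= counter s v &
    on s t u -> forall w, on s t w -> counter s w <= counter s v].
Proof.
rewrite /early_synch; case: ifP => [on_u|_]; last by exists u; rewrite eqxx.
set r := filter _ _.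
have r_on v : v \in r -> on s t v by rewrite mem_filter => /andP[/andP[]].
have on_r v : on s t v -> (v == u) || (v \in r).
  move=> on_v; rewrite mem_filter on_v andbT; case: eqVneq => //= _.
  by rewrite -[v](permKV (arrival sc t u)) map_f // mem_enum.
(* The fold is generalized to start from the pair of any processor [w] already accepted. *)
suff H l w : {subset l <= r} -> (w == u) || (w \in r) ->
    exists v, [/\ (v == u) || (v \in r),
      foldl (receive s u) (clock s w, counter s w) l = (clock s v, counter s v),
      counter s w <= counter s v &
      {in l, forall y, counter s y <= counter s v}].
  have [|v [vr -> uv rv]] := H r u (fun _ => id); first by rewrite eqxx.
  exists v; split=> // [|_ w /on_r/orP[/eqP->//|/rv//]].
  by case/orP: vr => [->|/r_on ->]; rewrite ?orbT.
elim: l w => [|y l IHl] w lr wr /=; first by exists w; split.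
have yr : y \in r by apply: lr; rewrite mem_head.
have {}lr : {subset l <= r} by move=> z zl; apply: lr; rewrite inE zl orbT.
rewrite /receive /=; case: ifP => wy.
  have [|v [vr e yv lv]] := IHl y lr; first by rewrite yr orbT.
  have wy' : counter s w <= counter s y.
    by case/orP: wy => [/ltnW|/andP[/eqP->]].
  exists v; split=> //; first exact: leq_trans yv.
  by move=> z; rewrite inE => /predU1P[->//|/lv].
have [v [vr e wv lv]] := IHl w lr wr; exists v; split=> //.
move=> z; rewrite inE => /predU1P[->|/lv//]; apply: leq_trans wv.
by move/negbT: wy; rewrite negb_or -leqNgt => /andP[].
Qed.

Lemma clock_before t u : t <= W u -> clock (st t) u = 0.
Proof. by case: t => [|t] //= tu; rewrite tu. Qed.

Lemma counter_wake u : counter (st (W u)) u = 0.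
Proof. by case e: (W u) => [|t] //=; rewrite /starts -/(W u) e eqxx. Qed.

Lemma counter_late u : counter (st (W u + (2 * n).+1)) u = 0.
Proof. by rewrite addnS /= /starts addnS eqxx orbT. Qed.

Lemma clock_step t u : W u <= t -> clock (st t.+1) u = (synch (st t) t u).1.+1.
Proof. by move=> ut /=; rewrite ltnNge ut. Qed.

Lemma counter_step t u : ~~ starts n k sc (main (st t.+1) u) t.+1 u ->
  counter (st t.+1) u = (synch (st t) t u).2.+1.
Proof. by move=> /negbTE /= ->. Qed.

Lemma hostP s t v u : host n k sc s t v = Some u -> enqueues n k sc s t u v.
Proof. by rewrite /host; case: pickP => // w ? [<-]. Qed.

Lemma enqueues_main s t u v : enqueues n k sc s t u v -> main s v = None.
Proof. by case/and5P=> _ _ _ /eqP. Qed.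


Lemma startsN t u :
  starts n k sc None t u = (t == W u) || (t == W u + (2 * n).+1).
Proof. by rewrite /starts (_ : None == Some _ = false) ?orbF. Qed.

Lemma main_next_keep s t v M : main s v = Some M -> ~~ creates n k sc s t v ->
  main_next n k sc s t v = Some M.
Proof.
move=> Mv /negbTE cv; rewrite /main_next cv.
by case e: (host _ _ _ _ _ _) => [u|//]; move: (enqueues_main (hostP e));
  rewrite Mv.
Qed.

Lemma main_keep t v M : main (st t) v = Some M -> t.+1 != W v + k ->
  main (st t.+1) v = Some M.
Proof.
by move=> Mv tv; apply: main_next_keep => //; rewrite /creates (negbTE tv).
Qed.

(** * Clusters *)

(* [D] gathers the processors of the clusters that ended by time [t0]. *)
Definition retired (D : {set 'I_m}) t0 : Prop :=
  forall x, x \in D -> W x + k <= t0 /\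
    forall t, t0 <= t -> exists2 M, main (st t) x = Some M & M + k ^ 2 <= t0.

(** [idle_card] charges [k ^ 2] elapsed time units to each processor of the ended clusters; this is
    what finally shows that some processor is still to come. *)
Record idle (D : {set 'I_m}) t0 : Prop := Idle {
  idle_card : #|D| * k ^ 2 <= t0;
  idle_retired : retired D t0;
  idle_queue : forall x, queue (st t0) x = [::];
  idle_fresh : forall x, x \notin D -> t0 <= W x /\ main (st t0) x = None }.

Hypotheses (W_le : forall u, W u <= n) (k_gt0 : 0 < k) (k_le : k <= n.+1).

Lemma retired_off (D : {set 'I_m}) t0 t x : retired D t0 -> x \in D -> t0 <= t ->
  t < W x + (2 * n).+1 -> on (st t) t x = false.
Proof.
move=> oldD xD t0t tlate; have [Wx /(_ _ t0t)[M Mx M_le]] := oldD _ xD.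
rewrite /radio_on Mx /wakeup_part /policy_on /in_initial /in_main -/(W x).
move: (k ^ 2) M_le (k %| _) (k %| _) => K *; lia.
Qed.

(** * Birth of a cluster around its first processor [c] *)

Section Cluster.

Variables (D : {set 'I_m}) (t0 : nat) (c : 'I_m).
Hypotheses (idleD : idle D t0) (cD : c \notin D).
Hypothesis c_first : forall x, x \notin D ->
  (W c < W x) || (W c == W x) && (x <= c).

Let S := W c + k.
Let oldD := idle_retired idleD.

Lemma W_first x : x \notin D -> W c <= W x.
Proof. by move/c_first; lia. Qed.

Lemma t0_le : t0 <= W c. Proof. by case: (idle_fresh idleD cD). Qed.

(* Until the main part of [c] starts, the only radios on are those of processors
   performing the initial part that follows their wake-up. *)
Lemma lobby_quiet t : t0 <= t < S ->
  (forall x, queue (st t) x = [::]) /\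
  (forall x, x \notin D -> main (st t) x = None).
Proof.
elim: t => [|t IHt] tS.
  have t00 : t0 = 0 by lia.
  by rewrite -t00; split=> [|x /(idle_fresh idleD)[]//]; apply: idle_queue idleD.
have [tt|tt] := eqVneq t0 t.+1.
  by rewrite -tt; split=> [|x /(idle_fresh idleD)[]//]; apply: idle_queue idleD.
have [|q0 M0] := IHt; first lia.
(* A creation would need [W x + k = t.+1 < S], whereas fresh processors wake up at [W c] or later
   and retired ones ended their initial part by [t0]. *)
have cr x : creates n k sc (st t) t x = false.
  rewrite /creates -/(W x); case: (boolP (x \in D)) => [/oldD[]|/W_first];
  rewrite /S in tS; case: eqP => //=; lia.
have mt x : maintains k (st t) t x = false by rewrite /maintains q0.
have hs x : host n k sc (st t) t x = None.
  by rewrite /host; case: pickP => // u; rewrite /enqueues cr mt /= !andbF.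
have qm x : queue_mid n k sc (st t) t x = [::].
  rewrite /queue_mid cr q0 /=; apply/eqP; rewrite -[_ == _]negbK -has_filter.
  by apply/hasPn => y _; rewrite hs.
split=> x.
  rewrite /= /queue_next; case: pickP => [y|_]; rewrite ?qm //.
  by case: ifP.
by move=> xD; rewrite /= /main_next cr hs M0.
Qed.

Lemma lobby_on t x : t0 <= t < S -> x \notin D ->
  on (st t) t x = wakeup_part k sc t x.
Proof.
move=> tS xD; have [_ M0] := lobby_quiet tS; rewrite /radio_on M0 //=.
rewrite /policy_on /in_initial /in_main -/(W x); have := W_first xD.
have := W_le c; rewrite /S in tS.
move: (k ^ 2) (k %| _) (wakeup_part _ _ _ _) => K *; lia.
Qed.

Lemma lobby_on_fresh t y : t0 <= t < S -> on (st t) t y ->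
  y \notin D /\ W y <= t.
Proof.
move=> tS; case: (boolP (y \in D)) => [yD|yD].
  rewrite (retired_off oldD) //; first by case/andP: tS.
  by move: tS; rewrite /S; have := W_le c; lia.
by rewrite lobby_on // /wakeup_part /in_initial -/(W y); lia.
Qed.

Lemma lobby_onE t y : W c <= t < S -> y \notin D -> W y <= t -> on (st t) t y.
Proof.
move=> tS yD yt; rewrite lobby_on //; last by have := t0_le; lia.
by have := W_first yD; move: tS; rewrite /S /wakeup_part /in_initial -/(W y); lia.
Qed.

(** All processors awake outside [D] overlap, and [c], awake first, has the maximal counter
    [t - W c]. By induction every processor awake before [t] carries the same pair; one waking at
    [t] has counter [0] and can prevail only if [c] itself wakes at [t]. *)
Lemma lobby_synch t x : W c <= t < S -> x \notin D -> W x <= t ->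
  synch (st t) t x = (t - W c, t - W c).
Proof.
elim/ltn_ind: t x => t IHt x tS xD xt.
have awake y : y \notin D -> W y < t ->
    clock (st t) y = t - W c /\ counter (st t) y = t - W c.
  case: t IHt tS {xt} => // t IHt tS yD; rewrite ltnS => yt.
  have cy := W_first yD.
  have [|_ M0] := @lobby_quiet t.+1; first by have := t0_le; lia.
  have ns : ~~ starts n k sc (main (st t.+1) y) t.+1 y.
    by rewrite M0 // startsN; have := W_le c; rewrite /S in tS; lia.
  rewrite clock_step // (counter_step ns) IHt //=; lia.
have waking y : W y = t -> clock (st t) y = 0 /\ counter (st t) y = 0.
  by move=> <-; rewrite counter_wake clock_before.
have ct0 : t0 <= t < S by have := t0_le; lia.
have [v [v_on -> _ v_max]] := early_synchP (st t) t x.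
have /v_max{}v_max := lobby_onE tS xD xt.
have := v_max c; rewrite lobby_onE //; last by case/andP: tS.
have [vD vt] : v \notin D /\ W v <= t.
  by case/predU1P: v_on => [->//|/andP[_ /lobby_on_fresh]]; apply.
move=> /(_ isT) cv.
case: (ltngtP (W v) t) vt => // [vt|vt] _; first by have [-> ->] := awake v vD vt.
have [ve1 ve2] := waking v vt; rewrite ve1 ve2 in cv *.
case: (ltngtP (W c) t) tS => // [ct|ct] _; last by rewrite ct subnn.
by have [_ e] := awake c cD ct; move: cv; rewrite e; lia.
Qed.

(* The main parts of the cluster are contiguous and have length [k ^ 2], so the
   heads of the queue are on in the last time unit of each period of length [k]
   counted from [S]; [period t] is the start of the period of [t], and [rank t] is
   the position in the queue of the head at time [t]. *)
Definition period t := S + (t - S) %/ k * k.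
Definition rank t := (t - S) %/ k ^ 2.

Lemma period_bounds t : S <= t -> S <= period t <= t /\ t < period t + k.
Proof.
rewrite /period => St; move: (divn_eq (t - S) k) (ltn_pmod (t - S) k_gt0).
by move: (_ %/ _ * _) (_ %% _) => a b; lia.
Qed.

Lemma period_start : period S = S.
Proof. by rewrite /period subnn div0n addn0. Qed.

Lemma period_step t : S <= t ->
  period t.+1 = if t.+1 == period t + k then t.+1 else period t.
Proof.
move=> St; have := divn_eq (t.+1 - S) k; have := ltn_pmod (t.+1 - S) k_gt0.
have [_] := period_bounds St; have := divn_eq (t - S) k.
rewrite /period subSn // divnS // /dvdn.
case: (_.+1 %% k) => [|b] /=; rewrite ?mul0n ?mulSn ?add0n ?add1n ?mulSn;
  move: (_ %/ _ * _) (_ %% _) => a r; case: eqP; lia.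
Qed.

(** It is [y] that precedes: this negates the test of [earliest], so hearing [y] bars [x] from
    creating a queue. *)
Definition earlier x y := ~~ ((W x < W y) || (W x == W y) && (y < x)).

Lemma earlier_heard t x y : y \in heard_next n k sc (st t) t x -> earlier x y ->
  earliest n k sc (st t) t x = false.
Proof.
move=> xy e; apply/negbTE; apply: contra e => /forallP/(_ y).
by rewrite xy.
Qed.

(* [L] lists the processors enqueued so far, including those already dequeued; if
   [t = S + size L * k ^ 2], the cluster is exhausted and all queues are empty. *)
Record cluster (L : seq 'I_m) t : Prop := Cluster {
  cl_uniq : uniq L;
  cl_creator : c \in L;
  cl_fresh : {in L, forall x, x \notin D};
  cl_awake : {in L, forall x, W x < t};
  cl_main : {in L, forall x, main (st t) x = Some (S + index x L * k ^ 2) /\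
    W x < S + index x L * k ^ 2};
  cl_queue : forall x,
    queue (st t) x = if index x L == rank t then drop (rank t) L else [::];
  cl_out : forall x, x \notin D -> x \notin L ->
    main (st t) x = None /\ period t <= W x;
  cl_heard : {in L, forall x, x != c ->
    exists2 y, y \in heard (st t) x & earlier x y} }.

Lemma mem_news s t u v :
  (v \in [seq v <- map (qorder sc t u) (enum 'I_m) | host n k sc s t v == Some u])
  = (host n k sc s t v == Some u).
Proof.
rewrite mem_filter -[v in X in _ && X](permKV (qorder sc t u)).
by rewrite map_f ?mem_enum // andbT.
Qed.

Lemma uniq_news s t u :
  uniq [seq v <- map (qorder sc t u) (enum 'I_m) | host n k sc s t v == Some u].
Proof.
by rewrite filter_uniq // map_inj_uniq ?enum_uniq //; apply: perm_inj.
Qed.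

Lemma k2_gt0 : 0 < k ^ 2. Proof. by rewrite expn_gt0 k_gt0. Qed.

Lemma heard_before t u : t <= W u -> heard (st t) u = set0.
Proof.
elim: t => //= t IHt tu; rewrite /heard_next /wakeup_part /in_initial.
by rewrite leq_add2r leqNgt tu IHt // ltnW.
Qed.

Lemma lobby_heard t y : W c <= t <= S -> y \in heard (st t) c ->
  y \notin D /\ y != c.
Proof.
elim: t => [|t IHt] tS; first by rewrite inE.
have [tc|tc] := leqP t.+1 (W c); first by rewrite heard_before // inE.
have tS' : W c <= t <= S by lia.
rewrite /= /heard_next; case: ifP => _; last exact: IHt.
rewrite !inE => /orP[|/andP[yc]]; first exact: IHt.
by case/lobby_on_fresh => //; have := t0_le; lia.
Qed.

(** In time unit [S - 1], the last of its initial part, [c] overlaps with every processor awake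
    outside [D]. Each of them hears [c] and is barred from creating, so [c] alone creates a queue
    and enqueues them all. *)
Lemma opening : exists L, cluster L S.
Proof.
have [t tS] : exists t, t.+1 = S.
  by exists S.-1; rewrite prednK // /S addn_gt0 k_gt0 orbT.
have tW : W c <= t < S by rewrite -tS leqnn -ltnS tS /S -addn1 leq_add2l k_gt0.
have t0t : t0 <= t < S by have := t0_le; lia.
have [q0 M0] := lobby_quiet t0t.
set s := st t.
have heard_c y : y \notin D -> W y <= t -> y != c -> c \in heard_next n k sc s t y.
  move=> yD yt yc; rewrite /heard_next -(lobby_on t0t yD) lobby_onE //.
  by rewrite in_setU inE eq_sym yc lobby_onE ?orbT //=; case/andP: tW.
have before_c y : y \notin D -> y != c -> earlier y c.
  move=> yD yc; have := c_first yD; rewrite /earlier.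
  have : val y <> val c by move=> /val_inj/eqP; apply/negP.
  move=> /= {yc}; lia.
have cr x : creates n k sc s t x = (x == c).
  rewrite /creates tS /S -/(W x); case: (eqVneq x c) => [->|xc].
    rewrite eqxx; apply/forallP => y; apply/implyP => yc.
    have /lobby_heard[|yD {}yc] : y \in heard (st t.+1) c by [].
      by rewrite tS /S; lia.
    have {}yc : y != c :> nat by [].
    by have := c_first yD; rewrite (ltn_neqAle y) yc.
  apply/negbTE/negP => /andP[/eqP xk]; have [xD|xD] := boolP (x \in D).
    by have [] := oldD xD; have := t0_le; lia.
  by rewrite (earlier_heard (heard_c x xD _ xc)) ?before_c //; lia.
have mt x : maintains k s t x = false by rewrite /maintains q0.
pose E x := [&& x != c, x \notin D & W x <= t].
have en u x : enqueues n k sc s t u x = (u == c) && E x.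
  rewrite /enqueues mt cr orbF /E.
  case: (eqVneq u c) => [->|uc]; last by rewrite !andbF.
  have on_c : on s t c by apply: lobby_onE => //; case/andP: tW.
  rewrite on_c /=; case: (eqVneq x c) => //= xc.
  apply/idP/idP => [/and3P[/(lobby_on_fresh t0t)[-> ->]]//|/andP[xD xt]].
  rewrite lobby_onE // M0 // /heard_next.
  rewrite -(lobby_on t0t cD) on_c in_setU inE xc lobby_onE ?orbT //.
have hs x : host n k sc s t x = if E x then Some c else None.
  rewrite /host; case: pickP => [u|/(_ c)]; rewrite en ?eqxx /=.
    by case/andP => /eqP-> ->.
  by move=> ->.
pose L := queue_mid n k sc s t c.
have LE x : (x \in L) = (x == c) || E x.
  by rewrite /L /queue_mid cr eqxx inE mem_news hs; case: (E x); rewrite ?eqxx.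
have qm x : x != c -> queue_mid n k sc s t x = [::].
  move=> xc; rewrite /queue_mid cr (negbTE xc) q0 /=; apply/eqP.
  rewrite -[_ == _]negbK -has_filter; apply/hasPn => y _; rewrite hs.
  by case: (E y) => //; rewrite eqE /= eq_sym.
exists L; split.
- rewrite /L /queue_mid cr eqxx /= uniq_news mem_news hs /E eqxx //.
- by rewrite LE eqxx.
- by move=> x; rewrite LE => /predU1P[->|/and3P[]].
- move=> x; rewrite LE => /predU1P[->|/and3P[_ _]]; rewrite -tS ltnS //.
  by case/andP: tW.
- move=> x; rewrite LE -tS /= /main_next cr; case: eqVneq => [->|xc] /=.
    by rewrite /L /queue_mid cr eqxx /= eqxx mul0n addn0 tS; split=> //;
      rewrite /S; lia.
  by move=> Ex; rewrite hs Ex /rounds cr eqxx subn0; case/and3P: Ex;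
    split=> //; lia.
- move=> x; rewrite /rank subnn div0n drop0 -[in LHS]tS /= /queue_next.
  case: pickP => [y|_]; first by rewrite /passes /completes mt.
  rewrite /completes mt /=; case: (eqVneq x c) => [->|xc].
    by rewrite /L {2}/queue_mid cr eqxx /= eqxx.
  by rewrite qm // /L {1}/queue_mid cr eqxx /= [c == x]eq_sym (negbTE xc).
- move=> x xD; rewrite LE /E xD negb_or period_start => /andP[xc].
  rewrite xc /= -ltnNge -tS => xt; split=> //.
  by rewrite /= /main_next cr (negbTE xc) hs /E xc xD /= leqNgt xt M0.
- move=> x; rewrite LE orbC => xL xc; move: xL; rewrite (negbTE xc) orbF.
  case/and3P => _ xD xt; exists c; last exact: before_c.
  by rewrite -tS; apply: heard_c.
Qed.

(** * One time unit of a running cluster, with head [u] and main part from [M] *)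

Section Turn.

Variables (L : seq 'I_m) (t : nat).
Hypotheses (cl : cluster L t) (St : S <= t) (tL : t < S + size L * k ^ 2).

Let s := st t.
Let h := rank t.
Let u := nth c L h.
Let M := S + h * k ^ 2.

Lemma rank_lt : h < size L.
Proof. by rewrite /h /rank ltn_divLR ?k2_gt0 // ltn_subLR. Qed.

Lemma head_in : u \in L. Proof. by rewrite mem_nth ?rank_lt. Qed.


Lemma index_head : index u L = h.
Proof. by rewrite index_uniq ?rank_lt ?(cl_uniq cl). Qed.

Lemma index_headE x : (index x L == h) = (x == u).
Proof.
apply/eqP/eqP => [e|->]; last exact: index_head.
by rewrite /u -e nth_index // -index_mem e rank_lt.
Qed.

Lemma head_main : main s u = Some M /\ W u < M.
Proof. by have := cl_main cl head_in; rewrite index_head. Qed.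

Lemma head_turn : M <= t < M + k ^ 2.
Proof.
have := leq_divM (t - S) (k ^ 2); have := ltn_ceil (t - S) k2_gt0.
by rewrite /M /h /rank mulSn; move: (_ %/ _ * _) => a; move: (k ^ 2) => K; lia.
Qed.

Lemma head_period : M <= period t.
Proof.
rewrite /M /period leq_add2l -mulnn mulnA leq_mul2r leq_divRL // -mulnA mulnn.
by rewrite leq_divM orbT.
Qed.

Lemma head_on : t.+1 = period t + k -> on s t u.
Proof.
move=> tp; have [Mu _] := head_main; rewrite /radio_on Mu /policy_on /in_main.
rewrite head_turn /= -subSn; last by case/andP: head_turn.
suff -> : k %| t.+1 - M by rewrite orbT orbT.
by rewrite tp /period /M addnAC -addnA subnDl dvdn_sub ?dvdn_addr ?dvdn_mull //
  -mulnn dvdn_mull.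
Qed.

Lemma maintainsE x : maintains k s t x = (x == u).
Proof.
rewrite /maintains (cl_queue cl) index_headE; case: (x =P u) => //= ->.
have [-> _] := head_main.
by rewrite /in_main head_turn andbT -size_eq0 size_drop subn_eq0 -ltnNge rank_lt.
Qed.

Lemma hears_head x : W x <= t < W x + k -> x != u -> on s t u ->
  u \in heard_next n k sc s t x.
Proof.
move=> xt xu on_u; rewrite /heard_next /wakeup_part /in_initial -/(W x).
have -> : (W x + k <= t + k) && (t < W x + k) by rewrite leq_add2r.
by rewrite !inE eq_sym xu on_u orbT.
Qed.

Lemma head_earlier x : x \notin D -> x \notin L -> earlier x u.
Proof.
move=> xD xL; have [_ xp] := cl_out cl xD xL; have [_ uM] := head_main.
by rewrite /earlier; have := head_period; lia.
Qed.

(** Retired processors and [c] are past their initial part, and the other members heard an earlier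
    processor. An outsider woke up in the current period, so its initial part can only end with that
    period, when it hears the head, which woke up before. *)
Lemma createsF x : creates n k sc s t x = false.
Proof.
rewrite /creates -/(W x); apply/negbTE/negP => /andP[/eqP tx].
have [xD|xD] := boolP (x \in D).
  by have [] := oldD xD; have := t0_le; have := St; rewrite /S; lia.
have [xL|xL] := boolP (x \in L).
  have [xc|xc] := eqVneq x c; first by have := St; rewrite /S -xc; lia.
  have [y yx e] := cl_heard cl xL xc.
  by rewrite (earlier_heard _ e) // /heard_next; case: ifP; rewrite ?inE ?yx.
have [_ xp] := cl_out cl xD xL; have [pt tp] := period_bounds St.
rewrite (earlier_heard (hears_head _ _ _) (head_earlier xD xL)) //; first lia.
  by apply: contra xL => /eqP->; apply: head_in.
by apply: head_on; lia.
Qed.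

Let news := [seq v <- map (qorder sc t u) (enum 'I_m) | host n k sc s t v ==
  Some u].

Lemma enqueuesE x v : enqueues n k sc s t x v -> x = u.
Proof. by case/and5P => _ _ _ _; rewrite createsF maintainsE => /and3P[/eqP]. Qed.

Lemma hostE v : host n k sc s t v = if enqueues n k sc s t u v then Some u else
  None.
Proof.
rewrite /host; case: pickP => [x ex|/(_ u)-> //].
by rewrite -(enqueuesE ex) ex.
Qed.

Lemma newsE v : (v \in news) = enqueues n k sc s t u v.
Proof. by rewrite mem_news hostE; case: ifP; rewrite ?eqxx. Qed.

Lemma news_fresh v : enqueues n k sc s t u v -> v \notin D /\ v \notin L.
Proof.
move=> /enqueues_main Mv; split; apply/negP.
  by move=> /oldD[_ /(_ t)[|M0]]; [have := t0_le; have := St; rewrite /S;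
    lia|rewrite -/s Mv].
by move=> /(cl_main cl)[]; rewrite -/s Mv.
Qed.

Lemma queue_midE x :
  queue_mid n k sc s t x = if x == u then drop h (L ++ news) else [::].
Proof.
rewrite /queue_mid createsF (cl_queue cl) index_headE.
case: eqVneq => [->|xu] /=.
  by rewrite drop_cat rank_lt.
apply/eqP; rewrite -[_ == _]negbK -has_filter; apply/hasPn => v _; rewrite hostE.
by case: ifP => // _; rewrite eqE /= eq_sym.
Qed.

Lemma main_nextE x : x \notin news -> main_next n k sc s t x = main s x.
Proof. by rewrite newsE /main_next createsF hostE => /negbTE->. Qed.

(** Positions in the remaining queue are lower by [h], and the head has performed [t.+1 - M] units;
    both shifts cancel, leaving a start counted from [S]. The subtraction does not truncate, as a
    new processor stands strictly behind the head. *)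
Lemma news_main x : x \in news ->
  main_next n k sc s t x = Some (S + index x (L ++ news) * k ^ 2) /\
  W x < S + index x (L ++ news) * k ^ 2.
Proof.
move=> xn; have := xn; rewrite newsE => ex; have [xD xL] := news_fresh ex.
rewrite /main_next createsF hostE ex queue_midE eqxx /rounds createsF.
have [-> _] := head_main.
rewrite index_drop ?size_cat; last by rewrite (leq_trans (ltnW rank_lt)) ?leq_addr.
  have: h < index x (L ++ news).
    by rewrite index_cat (negbTE xL) (leq_trans rank_lt) ?leq_addr.
  move: head_turn; rewrite /M; case/and5P: ex => _ _ _ _; rewrite createsF /=.
  case/and3P => _; rewrite /wakeup_part /in_initial -/(W x) => xt _.
  move: (index _ _) => i Mt hi; have -> : i = h + (i - h.+1).+1 by lia.
  rewrite addKn mulSn mulnDl mulSn; move: (_ * k ^ 2) (_ * k ^ 2) Mt => a b.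
  move: (k ^ 2) => K Mt; split; [congr Some|]; lia.
by rewrite take_cat rank_lt; apply: contra xL => /mem_take.
Qed.

Lemma rank_step : rank t.+1 = if t.+1 == M + k ^ 2 then h.+1 else h.
Proof.
have := divn_eq (t - S) (k ^ 2); have := divn_eq (t.+1 - S) (k ^ 2).
have := ltn_pmod (t.+1 - S) k2_gt0; have := ltn_pmod (t - S) k2_gt0.
rewrite /M /h /rank subSn // divnS ?k2_gt0 // /dvdn.
case: (_.+1 %% _) => [|b] /=; rewrite ?add0n ?add1n ?mulSn;
  move: (_ %% _) => r; move: (_ %/ _) => q; move: (q * _) => a;
  move: (k ^ 2) => K; case: eqP => //; lia.
Qed.

Lemma turn_end : t.+1 = M + k ^ 2 -> t.+1 = period t + k.
Proof.
move=> tM; have := period_step St; case: eqP => // _.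
have -> : period t.+1 = t.+1.
  rewrite /period {1}tM /M -addnA addKn -mulSnr -mulnn mulnA mulnK //.
  by rewrite tM /M -addnA -mulSnr -mulnn mulnA.
by have [] := period_bounds St; lia.
Qed.

Lemma uniq_next : uniq (L ++ news).
Proof.
rewrite cat_uniq (cl_uniq cl) uniq_news andbT /=; apply/hasPn => x /=.
by rewrite newsE => /news_fresh[].
Qed.

Lemma completesE x : completes k s t x = (x == u) && (t.+1 == M + k ^ 2).
Proof.
by rewrite /completes maintainsE; case: eqVneq => //= ->; have [-> _] := head_main.
Qed.

(** The handover never fails: the successor is either in the last unit of its initial part, or
    enqueued in this very unit and therefore on. *)
Lemma passesE x y : passes n k sc s t x y =
  [&& x == u, t.+1 == M + k ^ 2, h.+1 < size (L ++ news) &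
    index y (L ++ news) == h.+1].
Proof.
rewrite /passes completesE queue_midE; case: eqVneq => //= ->.
case: eqP => //= tM; rewrite -drop1 drop_drop add1n ohead_drop ?uniq_next //.
have -> : on s t u := head_on (turn_end tM).
case: ltnP => [hL|_]; last by []; case: eqP => [yh|_]; last by []; rewrite !andTb.
have : y \in L ++ news by rewrite -index_mem yh.
rewrite mem_cat newsE => /orP[yL|/and5P[]//].
have [My _] := cl_main cl yL; rewrite /radio_on -/s in My *; rewrite My.
have -> : S + index y L * k ^ 2 = t.+1.
  by move: yh; rewrite index_cat yL tM /M => ->; rewrite mulSn; lia.
have i_t : in_initial k t.+1 t by rewrite /in_initial; lia.
by rewrite /policy_on i_t orbT.
Qed.

Lemma queue_step x : queue (st t.+1) x =
  if index x (L ++ news) == rank t.+1 then drop (rank t.+1) (L ++ news) else [::].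
Proof.
rewrite /= /queue_next rank_step.
case: pickP => [y|no]; first rewrite passesE => /and4P[/eqP-> tM _ yh].
  by rewrite tM yh queue_midE eqxx -drop1 drop_drop add1n.
rewrite completesE queue_midE; case: (t.+1 =P M + k ^ 2) => tM;
  rewrite ?andbT ?andbF.
  have [hL|hL] := ltnP h.+1 (size (L ++ news)); last first.
    by rewrite (drop_oversize hL) if_same; case: (x == u).
  have := no u; rewrite passesE eqxx hL {1}tM eqxx /= => ->.
  by case: (x == u).
suff -> : (index x (L ++ news) == h) = (x == u) by [].
rewrite -index_headE index_cat; case: ifP => // /negbT.
rewrite -index_mem -leqNgt => xL.
by rewrite !gtn_eqF // (leq_trans rank_lt) ?leq_addr.
Qed.

(** The delicate invariant is [cl_out]. When a period ends, the head is on, and an awake outsider,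
    having woken up less than [k] units before, is still in its initial part; it hears the earlier
    head and is enqueued. *)
Lemma cluster_step : exists L', size L <= size L' /\ cluster L' t.+1.
Proof.
exists (L ++ news); split; first by rewrite size_cat leq_addr.
split.
- exact: uniq_next.
- by rewrite mem_cat (cl_creator cl).
- by move=> x; rewrite mem_cat newsE => /orP[/(cl_fresh cl)|/news_fresh[]].
- move=> x; rewrite mem_cat newsE => /orP[/(cl_awake cl)/leqW//|/and5P[_ _ _ _]].
  by rewrite createsF => /and3P[_];
    rewrite /wakeup_part /in_initial leq_add2r => /andP[].
- move=> x; rewrite mem_cat orbC;
  have [/news_main//|xn /= xL] := boolP (x \in news).
  by rewrite /= main_nextE // index_cat xL; apply: cl_main cl _ xL.
- exact: queue_step.
- move=> x xD; rewrite mem_cat negb_or => /andP[xL xn].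
  have [Mx px] := cl_out cl xD xL; rewrite /= main_nextE //; split=> //.
  rewrite period_step //; case: eqP => // tp; rewrite ltnNge;
    apply: contra xn => xt.
  have xu : x != u by apply: contra xL => /eqP->; apply: head_in.
  have xtk : W x <= t < W x + k by rewrite xt -[t < _]/(t.+1 <= _) tp leq_add2r.
  rewrite newsE /enqueues xu head_on // Mx maintainsE eqxx /=.
  rewrite (earlier_heard (hears_head _ _ (head_on _)) (head_earlier xD xL)) //=.
  have -> : wakeup_part k sc t x by rewrite /wakeup_part /in_initial leq_add2r.
  by rewrite /radio_on /wakeup_part /in_initial leq_add2r xtk orbT.
- move=> x; rewrite mem_cat orbC; have [xn _|xn /= xL] := boolP (x \in news).
    move: xn; rewrite newsE => /and5P[_ _ _ _]; rewrite createsF => /and3P[_ _].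
    by case/forallPn => y; rewrite negb_imply => /andP[xy e] _; exists y.
  move=> xc; have [y yx e] := cl_heard cl xL xc; exists y => //.
  by rewrite /= /heard_next; case: ifP; rewrite // inE yx.
Qed.

End Turn.

(** * Lifetime of a cluster *)

Definition active t := exists L, cluster L t /\ t < S + size L * k ^ 2.

Lemma cluster_run t : S <= t -> (forall t', S <= t' <= t -> active t') \/
  exists L E, [/\ cluster L E, E = S + size L * k ^ 2 & E <= t].
Proof.
move=> /subnKC <-; elim: (t - S) => [|i [IHi|[L [E [cl e Et]]]]].
- left=> t'; rewrite addn0 -eqn_leq => /eqP <-; have [L cl] := opening.
  exists L; split=> //; rewrite -[X in X < _]addn0 ltn_add2l muln_gt0 k2_gt0 andbT.
  by have := cl_creator cl; case: (L).
- have [|L [cl tL]] := IHi (S + i); first by rewrite leq_addr leqnn.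
  have [L' [LL' cl']] := cluster_step cl (leq_addr _ _) tL.
  have : (S + i).+1 <= S + size L' * k ^ 2.
    by rewrite (leq_trans tL) // leq_add2l leq_mul2r LL' orbT.
  rewrite leq_eqVlt => /orP[/eqP e|t'L].
    by right; exists L', (S + i).+1; rewrite addnS.
  left=> t'; rewrite addnS => /andP[St]; rewrite leq_eqVlt => /orP[/eqP->|t'i].
    by exists L'.
  by apply: IHi; rewrite St.
- by right; exists L, E; rewrite addnS (leqW Et).
Qed.

Lemma period_id t : S <= t -> k %| t - S -> period t = t.
Proof. by move=> St kt; rewrite /period divnK // subnKC. Qed.

(** [E] is a period boundary, so by [cl_out] a processor never enqueued wakes up at [E] or later;
    the main parts of all members are over by then. *)
Lemma cluster_end L E : cluster L E -> E = S + size L * k ^ 2 ->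
  idle (D :|: [set x in L]) E.
Proof.
move=> cl e; have t0S : t0 <= S by rewrite (leq_trans t0_le) ?leq_addr.
have SE : S <= E by rewrite e leq_addr.
have kk2 : k <= k ^ 2 by rewrite -mulnn leq_pmulr.
split.
- rewrite e; apply: leq_trans (leq_mul (leq_card_setU _ _) (leqnn _)) _.
  rewrite mulnDl leq_add //; first by rewrite (leq_trans (idle_card idleD)).
  by rewrite leq_mul2r cardsE card_size orbT.
- move=> x; rewrite !inE => /orP[/oldD[xk Mx]|xL].
    split=> [|t Et]; first by lia.
    by have [|M Me ?] := Mx t; [lia|exists M => //; lia].
  have [Mx xM] := cl_main cl xL.
  have ME : S + index x L * k ^ 2 + k ^ 2 <= E.
    by rewrite e -addnA -mulSnr leq_add2l leq_mul2r index_mem xL orbT.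
  split=> [|t /subnKC <-]; first by lia.
  exists (S + index x L * k ^ 2) => //; elim: (t - E) => [|i IHi].
    by rewrite addn0.
  by rewrite addnS; apply: main_keep => //; lia.
- move=> x; rewrite (cl_queue cl) (_ : rank E = size L) ?drop_size ?if_same //.
  by rewrite /rank e addKn mulnK // k2_gt0.
- move=> x; rewrite !inE negb_or => /andP[xD xL].
  have [Mx] := cl_out cl xD xL; rewrite period_id //.
  by rewrite e addKn -mulnn mulnA dvdn_mull.
Qed.

(** * Agreement of the clocks with a running cluster *)

Section Sync.

Let t1 := W c + (2 * n).+1.

Hypotheses (n_gt0 : 0 < n) (act : forall t, S <= t < t1 -> active t).

(* [base x] is the time from which [x] takes part: the earlier clusters come back
   with their late policies.  [cov x t] says that [x] is performing an initial part
   that lasts at least to the end of the current period. *)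
Let good x t := clock (st t) x + W c = t.
Let base x := if x \in D then W x + (2 * n).+1 else W x.
Let cov x t := (period t <= base x) || (main (st t) x == Some (period t + k)).

Lemma W_base x : W x <= base x.
Proof. by rewrite /base; case: ifP; rewrite ?leq_addr. Qed.

Lemma counter_base x : counter (st (base x)) x = 0.
Proof. by rewrite /base; case: ifP; rewrite ?counter_late ?counter_wake. Qed.

Lemma retired_main t x : S <= t -> x \in D ->
  exists2 M, main (st t) x = Some M & M <= t.
Proof.
move=> St /oldD[_ /(_ t)[|M Mx Mt]].
  by rewrite (leq_trans t0_le) // (leq_trans _ St) ?leq_addr.
by exists M => //; have := t0_le; have := St; rewrite /S; lia.
Qed.

Lemma main_phase t x M : S <= t < t1 -> x \notin D -> main (st t) x = Some M ->
  S <= M /\ k %| M - S.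
Proof.
move=> tS xD Mx; have [L [cl _]] := act tS.
have [xL|xL] := boolP (x \in L); last by have [] := cl_out cl xD xL; rewrite Mx.
have [] := cl_main cl xL; rewrite Mx => -[->] _.
by rewrite leq_addr addKn -mulnn mulnA dvdn_mull.
Qed.

Lemma main_persists t x M : S <= t < t1 -> main (st t) x = Some M ->
  main (st t.+1) x = Some M.
Proof.
move=> tS Mx; have [L [cl tL]] := act tS; have /andP[St _] := tS.
by apply: main_next_keep => //; rewrite (createsF cl St tL).
Qed.

Lemma on_base t x : S <= t < t1 -> on (st t) t x -> base x <= t.
Proof.
move=> tS; apply: contraLR; rewrite -ltnNge /base; have [xD|xD] := boolP (x \in D).
  move=> xt; rewrite (retired_off oldD) //; rewrite (leq_trans t0_le) //.
  by have := tS; rewrite /S; lia.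
move=> xt; have [L [cl tL]] := act tS.
have [xL|xL] := boolP (x \in L); first by have := cl_awake cl xL; lia.
have [Mx _] := cl_out cl xD xL; rewrite /radio_on Mx /=.
rewrite /wakeup_part /policy_on /in_initial /in_main -/(W x).
by move: (k ^ 2) (k %| _) => K b; lia.
Qed.

Lemma cov_on t x : S <= t < t1 -> base x <= t -> cov x t -> on (st t) t x.
Proof.
move=> /andP[St _] xt; have [pt tp] := period_bounds St.
rewrite /cov /radio_on => /orP[px|/eqP->]; last first.
  have i_t : in_initial k (period t + k) t by rewrite /in_initial; lia.
  by rewrite /policy_on i_t orbT.
move: xt px; rewrite /base; case: ifP => _ xt px.
  have i_t : in_initial k (W x + (2 * n).+1 + k) t by rewrite /in_initial; lia.
  by rewrite [X in [|| _, _ | X]]/policy_on i_t !orbT.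
by have -> : wakeup_part k sc t x by rewrite /wakeup_part /in_initial -/(W x); lia.
Qed.

(** A clock that disagrees belongs to a processor whose counter is at most [t - period t], hence
    below [k]: it loses against any counter of at least [k]. *)
Definition informed t := forall x, base x <= t ->
  if cov x t then good x t \/ counter (st t) x <= t - period t
  else good x t /\ k <= counter (st t) x.

Lemma informed_good t x : S <= t -> informed t -> base x <= t ->
  k <= counter (st t) x -> good x t.
Proof.
move=> St + xt kx => /(_ x xt); case: ifP => _ [] // xp.
by have := period_bounds St; lia.
Qed.

(** An adopted counter of at least [k] guarantees a good clock. If [x] is not covered, its own
    counter is that large; at the end of a period [x] hears the head, which is in its main part and
    hence not covered. *)
Lemma informed_synch t x : S <= t < t1 -> informed t -> base x <= t ->
  t.+1 = period t + k \/ ~~ cov x t ->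
  good x t.+1 /\ k <= (synch (st t) t x).2.
Proof.
move=> tS inf xt strong; have /andP[St _] := tS.
have [v [vx e xv v_max]] := early_synchP (st t) t x.
have vt : base v <= t by case/predU1P: vx => [->//|/andP[_ /on_base]]; apply.
suff kv : k <= counter (st t) v.
  rewrite e; split=> //; rewrite /good clock_step ?(leq_trans (W_base x)) //.
  by rewrite e /= addSn (informed_good St inf).
have [xc|xc] := boolP (cov x t); last first.
  by have := inf x xt; rewrite (negbTE xc) => -[_ kx]; apply: leq_trans xv.
have tp : t.+1 = period t + k by case: strong => //; rewrite xc.
have [L [cl tL]] := act tS.
have /v_max{}v_max : on (st t) t x by apply: cov_on.
have := v_max _ (head_on cl St tL tp); apply: leq_trans.
have [] := head_main cl St tL; set u := nth _ _ _ => Mu uM.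
have uL : u \in L := head_in St tL.
have /andP[Mt _] := head_turn St tL; have Mp := head_period t.
have ub : base u = W u by rewrite /base (negbTE (cl_fresh cl uL)).
have := inf u; rewrite ub => /(_ (leq_trans (ltnW uM) Mt)).
rewrite ifF; first by case.
rewrite /cov Mu ub -tp leqNgt (leq_trans uM Mp) /=.
by apply/eqP => -[] eM; move: Mt; rewrite eM ltnn.
Qed.

(** Main parts start at multiples of [k] counted from [S], so a counter is reset at a period
    boundary and the initial part then fills the period. The late policies of processors outside [D]
    start no earlier than [t1]. *)
Lemma restart_cov t x : S <= t -> t.+1 < t1 -> base x <= t ->
  starts n k sc (main (st t.+1) x) t.+1 x -> cov x t.+1.
Proof.
move=> St tt1 xt; have St' : S <= t.+1 by apply: leqW.
have xW := W_base x; rewrite /starts -/(W x) => /or3P[/eqP|/eqP e|/eqP Mx].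
- by lia.
- have [xD|/W_first xD] := boolP (x \in D); last by move: tt1; rewrite e /t1; lia.
  by move: xt; rewrite /base xD; lia.
have [xD|xD] := boolP (x \in D).
  by have [M] := retired_main St' xD; rewrite Mx => -[<-]; lia.
have [|SM kM] := main_phase _ xD Mx; first by rewrite St'.
rewrite /cov period_id // ?Mx ?eqxx ?orbT //.
by rewrite -(dvdn_addl _ (dvdnn k)) addnBAC.
Qed.

Lemma informed_start : informed S.
Proof.
have SW := W_le c.
have [t tS] : exists t, t.+1 = S.
  by exists S.-1; rewrite prednK // /S addn_gt0 k_gt0 orbT.
move=> x xS; case: (ltngtP (base x) S) (xS) => // [{}xS|e] _; last first.
  rewrite /cov period_start e leqnn; right.
  by rewrite -e counter_base.
have xD : x \notin D.
  by apply/negP => xD; move: xS; rewrite /base xD /S; have := k_le; lia.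
have bx : base x = W x by rewrite /base (negbTE xD).
have cx := W_first xD; rewrite bx in xS.
have xt : W x <= t by lia.
have ts : synch (st t) t x = (t - W c, t - W c).
  by apply: lobby_synch => //; rewrite tS leqnn andbT; lia.
have gx : good x S by rewrite /good -tS clock_step // ts /= ; lia.
case: ifP => xc; first by left.
split=> //; rewrite -tS counter_step ?ts /=; first by move: tS; rewrite /S; lia.
apply/negP; rewrite tS /starts -/(W x) => /or3P[/eqP|/eqP|/eqP Mx]; try lia.
move: Mx; rewrite -[main_next _ _ _ _ _ _]/(main (st t.+1) x) tS => Mx.
by move: xc; rewrite /cov period_start Mx eqxx orbT.
Qed.

(** Inside a period a covered [x] stays covered: it adopts either a good clock or a small counter,
    which grows by one together with [t - period t]. *)
Lemma informed_step t : S <= t -> t.+1 < t1 -> informed t -> informed t.+1.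
Proof.
move=> St tt1 inf x; have tS : S <= t < t1 by lia.
have pt := period_step St; have [pt0 tp0] := period_bounds St.
rewrite leq_eqVlt => /orP[/eqP e|xt].
  rewrite /cov e; have [/andP[_ ->] _] := @period_bounds t.+1 (leqW St).
  by right; rewrite -e counter_base.
have [/orP strong|] := boolP ((t.+1 == period t + k) || ~~ cov x t).
  have [gx kx] : good x t.+1 /\ k <= (synch (st t) t x).2.
    by apply: informed_synch => //; case: strong => [/eqP|]; [left|right].
  case: ifP => xc; first by left.
  split=> //; rewrite counter_step ?leqW //.
  by apply/negP => /(restart_cov St tt1 xt); rewrite xc.
rewrite negb_or negbK => /andP[tp xc]; rewrite (negbTE tp) in pt.
have -> : cov x t.+1.
  case/orP: xc => [xp|/eqP Mx]; rewrite /cov pt ?xp //.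
  by rewrite (main_persists tS Mx) eqxx orbT.
have [v [vx e xv v_max]] := early_synchP (st t) t x.
have vt : base v <= t by case/predU1P: vx => [->//|/andP[_ /on_base]]; apply.
have [gv|pv] : good v t \/ counter (st t) v <= t - period t.
- by have := inf v vt; case: ifP => _ []; [left|right|left].
- left; rewrite /good clock_step ?(leq_trans (W_base x)) // e /=.
  by rewrite addSn gv.
right; rewrite pt; case: (boolP (starts n k sc (main (st t.+1) x) t.+1 x)) => s.
  by rewrite /= s.
by rewrite (counter_step s) e /=; lia.
Qed.

Lemma informed_all t : S <= t < t1 -> informed t.
Proof.
move=> /andP[/subnKC <-]; elim: (t - S) => [|i IHi] tt1.
  by rewrite addn0; apply: informed_start.
by rewrite addnS in tt1 *; apply: informed_step => //;
  [rewrite leq_addr|apply: IHi; lia].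
Qed.

Lemma cluster_synchronized : k <= n ->
  exists2 t, n <= t & forall x, clock (st t) x + W c = t.
Proof.
move=> kn; have St1 : S + k <= t1 by rewrite /S /t1; lia.
have [pt tp] := @period_bounds t1 (leq_trans (leq_addr _ _) St1).
have [t et] : exists t, t.+1 = period t1.
  by exists (period t1).-1; rewrite prednK //; lia.
have tS : S <= t < t1 by lia.
have tk : t.+1 = period t + k.
  have /andP[St _] := tS; have := period_step St; case: eqP => // _.
  have -> : period t.+1 = t.+1.
    by rewrite et period_id; [|lia|rewrite /period addKn dvdn_mull].
  by have [] := period_bounds St; lia.
exists t.+1 => [|x]; first by move: et tp; rewrite /t1; lia.
(* A retired [x] has [W x + k <= t0 <= W c], so its late policy starts by [t1 - k], strictly before
   the last period boundary up to [t1]. *)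
have xt : base x <= t.
  rewrite /base; case: ifP => [/oldD[xk _]|_]; last by have := W_le x;
    move: et tp; rewrite /t1; lia.
  by have := t0_le; move: et tp; rewrite /t1; lia.
by have [] := informed_synch tS (informed_all tS) xt (or_introl tk).
Qed.

End Sync.

End Cluster.

(** * Succession of clusters until agreement *)

Lemma first_waker (D : {set 'I_m}) x0 : x0 \notin D -> exists2 c, c \notin D &
  forall x, x \notin D -> (W c < W x) || (W c == W x) && (x <= c).
Proof.
(* Lexicographic order: wake-up date first, then larger Ids first, as [m - x < m.+1]. *)
move=> x0D; pose key x := W x * m.+1 + (m - x).
case: (@arg_minnP _ x0 [pred x | x \notin D] key x0D) => c cD cmin;
  exists c => // x xD.
have := cmin x xD; rewrite /key; have [//|xc|->] := ltngtP (W c) (W x).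
  have : (W x).+1 * m.+1 <= W c * m.+1 by rewrite leq_mul2r xc orbT.
  by rewrite mulSn; move: (W x * _) (W c * _) => a b; lia.
by rewrite leq_add2l /=; have := ltn_ord x; have := ltn_ord c; lia.
Qed.

(** Once all clocks agree, any adopted message carries the common value, so no later exchange can
    break the agreement. *)
Lemma agreement_synchronizes t : (forall u, W u <= t) ->
  (forall u v, clock (st t) u = clock (st t) v) -> synchronizes n k sc.
Proof.
move=> Wt agree; exists t; split=> // t' /subnKC <-.
elim: (t' - t) => [|i IHi] u v; first by rewrite addn0; apply: agree.
have synchE x : (synch (st (t + i)) (t + i) x).1 = clock (st (t + i)) u.
  by have [y [_ -> _ _]] := early_synchP (st (t + i)) (t + i) x; apply: IHi.
by rewrite addnS !clock_step ?synchE // (leq_trans (Wt _)) ?leq_addr.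
Qed.

Lemma idle_start : idle set0 0.
Proof.
by split=> [|x||x]; rewrite ?cards0 ?inE.
Qed.

(* Since [m * k ^ 2] exceeds the span of the time units before the late policies,
   a cluster that does not last until these policies leaves processors to
   wake up, hence another cluster. *)
Lemma idle_synchronizes (D : {set 'I_m}) t0 : 0 < n -> k <= n ->
  8 * n <= m * k ^ 2 -> idle D t0 -> D != setT -> synchronizes n k sc.
Proof.
move=> n_gt0 kn mk; have [i] := ubnP #|~: D|.
elim: i D t0 => // i IHi D t0 Di idleD DT.
have [x0 x0D] : exists x, x \notin D.
  by apply/existsP; rewrite -negb_forall; apply: contra DT => /forallP DT;
     apply/eqP/setP => x; rewrite inE DT.
have [c cD c_first] := first_waker x0D.
have Sn : W c + k <= W c + (2 * n) by lia.
have [act|[L [E [cl eE En]]]] := cluster_run idleD cD c_first Sn.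
  have [|t nt ct] := cluster_synchronized idleD cD c_first n_gt0 _ kn.
    by move=> t tS; apply: act; lia.
  apply: (@agreement_synchronizes t) => [u|u v]; first exact: leq_trans nt.
  by apply: (@addIn (W c)); rewrite !ct.
have idleD' := cluster_end idleD cD cl eE.
have cL := cl_creator cl.
apply: (IHi _ _ _ idleD').
  rewrite -ltnS (leq_trans _ Di) // ltnS proper_card // properC properE subsetUl.
  by apply/subsetPn; exists c; rewrite // !inE cL orbT.
(* Otherwise [8 * n <= m * k ^ 2 <= E <= W c + 2 * n <= 3 * n]. *)
apply/eqP => D'T; have := idle_card idleD'.
rewrite D'T cardsT card_ord; have := W_le c; lia.
Qed.

(** All processors wake up during the initial part of the first one and adopt its clock there. *)
Lemma slow_synchronizes : n < k -> synchronizes n k sc.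
Proof.
move=> nk; have [x0 _|I0] := pickP (@predT 'I_m); last first.
  by exists 0; split=> [u|? _ u]; have := I0 u.
have [|c cD c_first] := @first_waker set0 x0; first by rewrite inE.
have [t tS] : exists t, t.+1 = W c + k.
  by exists (W c + k).-1; rewrite prednK // addn_gt0 k_gt0 orbT.
have Wt u : W u <= t by have := W_le u; lia.
apply: (@agreement_synchronizes t.+1) => [u|u v]; first exact: leqW.
have cl x : clock (st t.+1) x = (t - W c).+1.
  rewrite clock_step // (lobby_synch idle_start cD c_first) ?inE //.
  by rewrite tS Wt leqnn.
by rewrite !cl.
Qed.

End Procedure.

(** * Energy *)

Lemma sum_bool_le (p : pred nat) (r : seq nat) N :
  (forall t, t < N -> p t -> t \in r) -> \sum_(t < N) p t <= size r.
Proof.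
move=> pr; rewrite -(big_mkord predT (fun t => p t : nat)) /index_iota subn0.
rewrite (eq_bigr (fun t => if p t then 1 else 0)); last by move=> t _; case: (p t).
rewrite -big_mkcond sum1_count -size_filter uniq_leq_size ?filter_uniq
  ?iota_uniq //.
by move=> t; rewrite mem_filter mem_iota => /andP[pt /andP[_ tN]]; apply: pr.
Qed.

(** For [M < k] the truncated [M - k] makes the first block start at [0]; it still contains the
    initial part. *)
Definition policy_times k M : seq nat :=
  iota (M - k) k ++ [seq (M + j.+1 * k).-1 | j <- iota 0 k].

Lemma policy_times_on k M t : policy_on k M t -> t \in policy_times k M.
Proof.
rewrite mem_cat mem_iota => /orP[|/andP[/andP[Mt tM] /dvdnP[[|q] e]]] //.
  by rewrite /in_initial; lia.
apply/orP; right; apply/mapP; exists q; last by lia.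
rewrite mem_iota /=; have : q.+1 * k <= k * k by rewrite -e mulnn; lia.
by rewrite leq_mul2r; case: eqP => // k0; rewrite k0 muln0 in e.
Qed.

(** A known main part can change only by the creation of a queue at the end of the wake-up initial
    part, so it is constant on either side of that date. *)
Lemma main_late n m k (sc : scenario m) u t M i :
  main (run n k sc t) u = Some M -> (t + i < wake sc u + k) || (wake sc u + k
    <= t) ->
  main (run n k sc (t + i)) u = Some M.
Proof.
move=> Mt; elim: i => [|i IHi] ti; first by rewrite addn0.
by rewrite addnS; apply: main_keep; [apply: IHi|]; lia.
Qed.

(** The wake-up part costs [k], and [2 * k] is paid for each of three policies: the one known before
    [W + k], the one known from then on, and the late one. *)
Lemma energy_le n m k (sc : scenario m) u N : energy n k sc u N <= 7 * k.
Proof.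
set W := wake sc u; pose Mat t := odflt 0 (main (run n k sc t) u).
pose r := iota W k ++ policy_times k (Mat (W + k).-1) ++ policy_times k (Mat N) ++
  policy_times k (W + (2 * n).+1 + k).
have -> : 7 * k = size r by rewrite /r !(size_cat, size_map, size_iota); lia.
apply: (@sum_bool_le (fun t => radio_on n k sc (run n k sc t) t u)) => t tN;
  rewrite /r.
rewrite (mem_cat _ (iota _ _)) !(mem_cat _ (policy_times k (Mat _))) => /or3P[| |].
- by rewrite mem_iota /wakeup_part /in_initial -/W => tk; apply/orP; left; lia.
- case Mt: (main _ _) => [M|] // /policy_times_on tM.
  have [tW|tW] := ltnP t (W + k).
    suff -> : Mat (W + k).-1 = M by rewrite tM orbT.
    rewrite /Mat (_ : (W + k).-1 = t + ((W + k).-1 - t)); last by lia.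
    by rewrite (main_late Mt) // -/W; lia.
  suff -> : Mat N = M by rewrite tM !orbT.
  by rewrite /Mat -(subnKC (ltnW tN)) (main_late Mt) // -/W; lia.
- by move=> /policy_times_on->; rewrite !orbT.
Qed.

Import Order.TTheory GRing.Theory Num.Theory.
Local Open Scope ring_scope.

(** * Size of the policy parameter [k] *)

Section PolicyLength.

Variables (R : realType) (n m : nat).
Hypothesis m_gt0 : (0 < m)%N.

Let y : R := Num.sqrt (n%:R / m%:R).
Let x : R := Num.sqrt (8 * n%:R / m%:R).
Let k := synch_k R n m.

Lemma ratio_ge0 : 0 <= n%:R / m%:R :> R.
Proof. by rewrite divr_ge0. Qed.

Lemma synch_k_ceil : k%:R = (Num.ceil x)%:~R :> R.
Proof.
have x0 : 0 <= Num.ceil x by rewrite ceil_ge0 (lt_le_trans _ (sqrtr_ge0 _)) //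
  ltrN10.
by rewrite -[in RHS](gez0_abs x0) pmulrn.
Qed.

Lemma synch_k_square : (8 * n <= m * k ^ 2)%N.
Proof.
rewrite -(ler_nat R) (natrM _ 8) (natrM _ m) natrX [leRHS]mulrC -ler_pdivrMr
  ?ltr0n //.
have <- : x ^+ 2 = 8 * n%:R / m%:R by rewrite sqr_sqrtr // -mulrA mulr_ge0
  ?ratio_ge0.
by rewrite synch_k_ceil lerXn2r ?nnegrE ?sqrtr_ge0 ?ceil_ge // (le_trans
  (sqrtr_ge0 _) (ceil_ge x)).
Qed.

(** For [m >= 2], [8 * n / m <= 4 * n <= (n + 1) ^ 2]. *)
Lemma synch_k_le : (1 < m)%N -> (k <= n.+1)%N.
Proof.
move=> m1; rewrite -(ler_nat R) synch_k_ceil pmulrn ler_int ceil_le_int -pmulrn.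
rewrite -[leRHS]ger0_norm ?ler0n // -sqrtr_sqr ler_wsqrtr // ler_pdivrMr ?ltr0n //.
rewrite -natrX -!natrM ler_nat; have : (n.+1 ^ 2 * 2 <= n.+1 ^ 2 * m)%N.
  by rewrite leq_mul2l m1 orbT.
by apply: leq_trans; rewrite -mulnn; nia.
Qed.

(** [8 <= 3 ^ 2] gives [x <= 3 * y], and rounding up adds less than [1 <= z]. Both [y] itself and
    its ceiling serve as [z]. *)
Lemma synch_k_bound (z : R) : 1 <= z -> y <= z -> k%:R <= 4 * z.
Proof.
move=> z1 yz; rewrite synch_k_ceil.
have := ceilB1_lt x; rewrite intrB.
have xy : x <= 3 * y.
  rewrite -[3]ger0_norm // -sqrtr_sqr -sqrtrM ?sqr_ge0 // ler_wsqrtr //.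
  by rewrite -mulrA ler_wpM2r ?ratio_ge0 // -natrX ler_nat.
lra.
Qed.

End PolicyLength.

Theorem theorem3p9 (R : realType) :
  exists C : R, 0 < C /\
    forall (n m : nat) (sc : scenario m),
      (forall u : 'I_m, (wake sc u <= n)%N) ->
      let k := synch_k R n m in
      [/\ synchronizes n k sc,
          forall (u : 'I_m) (N : nat),
            (energy n k sc u N)%:R
              <= C * (Num.ceil (Num.sqrt (n%:R / m%:R : R)))%:~R
        & (m <= n)%N -> forall (u : 'I_m) (N : nat),
            (energy n k sc u N)%:R <= C * Num.sqrt (n%:R / m%:R)].
Proof.
(* [28 = 7 * 4]: energy at most [7 * k], with [k <= 4 * z]. *)
exists 28; split=> // n m sc Wn k.
have energy_k (z : R) u N : k%:R <= 4 * z -> (energy n k sc u N)%:R <= 28 * z.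
  move=> kz; have : (energy n k sc u N)%:R <= (7 * k)%:R :> R.
    by rewrite ler_nat energy_le.
  by rewrite natrM; lra.
have [m0|m_gt0] := posnP m.
  have no (u : 'I_m) : False by case: u => i; rewrite m0.
  by split=> [|u|_ u]; [exists 0%N; split=> [u|? _ u]|..]; have := no u.
have [n0|n_gt0] := posnP n.
  have kE : k = 0%N by rewrite /k /synch_k n0 mulr0 mul0r sqrtr0 ceil0.
  have energy0 (z : R) u N : 0 <= z -> (energy n k sc u N)%:R <= 28 * z.
    by move=> z0; apply: energy_k; rewrite kE mulr_ge0.
  have y0 : 0 <= Num.sqrt (n%:R / m%:R) :> R := sqrtr_ge0 _.
  split=> [|u N|_ u N]; last exact: energy0.
    apply: (@agreement_synchronizes _ _ _ _ 0%N) => // u.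
    by have := Wn u; rewrite n0.
  by apply: energy0; apply: le_trans y0 (ceil_ge _).
have mk : (8 * n <= m * k ^ 2)%N := synch_k_square R n m_gt0.
have k_gt0 : (0 < k)%N by rewrite lt0n; apply: contraTneq mk => ->;
  rewrite muln0 -ltnNge; lia.
split=> [|u N|mn u N]; last 2 first.
- apply/energy_k/synch_k_bound => //; last exact: ceil_ge.
  by rewrite ler1z -gtz0_ge1 ceil_gt0 sqrtr_gt0 divr_gt0 ?ltr0n.
- apply/energy_k/synch_k_bound => //.
  rewrite -[leLHS]sqrtr1 ler_wsqrtr // ler_pdivlMr ?ltr0n // mul1r.
  by rewrite ler_nat.
(* A single processor agrees with itself; from two on, [k <= n.+1] is available. *)
have [m1|m1] := leqP m 1.
  apply: (@agreement_synchronizes _ _ _ _ n) => // u v; suff -> : u = v by [].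
  by apply/val_inj => /=; have := ltn_ord u; have := ltn_ord v; lia.
have k_le := synch_k_le R n m_gt0 m1.
have [kn|nk] := leqP k n; last exact: slow_synchronizes.
apply: (idle_synchronizes Wn k_gt0 k_le n_gt0 kn mk (idle_start _ _ _)).
by apply/eqP => /setP/(_ (Ordinal m_gt0)); rewrite !inE.
Qed.
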